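(* Let $G$ be a finitely generated group with word length $L$, let $\sigma$ be a submultiplicative growth function and let $R\ge0$. Then $\mathfrak{c}^0_{L,\sigma,-R}(G)$ is a sub-bimodule of $\ell^\infty_{L,\sigma,-R}(G)$ over the Banach algebra $\ell^1_{L,\sigma,R}(G)$; that is, $ab,\,ba\in\mathfrak{c}^0_{L,\sigma,-R}(G)$ for all $a\in\ell^1_{L,\sigma,R}(G)$ and $b\in\mathfrak{c}^0_{L,\sigma,-R}(G)$.
   Context: The word length $L(g)\in\mathbb{N}_0$, with respect to a finite generating set $S=S^{-1}$ of $G$, is the minimal number of elements of $S$ needed to write $g$ as a product, $L(e)=0$. A growth function is a map $\sigma\colon\mathbb{N}_0\to[1,\infty)$ that is monotonically increasing ($\sigma(n)\le\sigma(n+1)$) and unbounded; it is submultiplicative if $\sigma(n+m)\le\sigma(n)\sigma(m)$ for all $n,m$. $\mathbb{C}[[G]]$ is the space of all formal series $a=\sum_{g\in G}a_g\mathsf{e}_g$, $a_g\in\mathbb{C}$. Put $\|a\|_{L,\sigma,R}=\sum_g|a_g|\sigma(L(g))^R$ and $\ell^1_{L,\sigma,R}(G)=\{a\in\mathbb{C}[[G]]:\|a\|_{L,\sigma,R}<\infty\}$, a Banach algebra with product $(ab)_h=\sum_{g}a_g b_{g^{-1}h}$. Put $\|b\|_{\ell^\infty,L,\sigma,-R}=\sup_g|b_g|/\sigma(L(g))^R$ and $\ell^\infty_{L,\sigma,-R}(G)=\{b\in\mathbb{C}[[G]]:\|b\|_{\ell^\infty,L,\sigma,-R}<\infty\}$,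 which is a Banach bimodule over $\ell^1_{L,\sigma,R}(G)$ via $(ab)_h=\sum_g a_g b_{g^{-1}h}$ and $(ba)_h=\sum_g b_g a_{g^{-1}h}$. Finally, $\mathfrak{c}^0_{L,\sigma,-R}(G)$ is the set of all $b\in\mathbb{C}[[G]]$ such that for every $\epsilon>0$ there is a finite subset $K\subseteq G$ with $\sup_{g\in G\setminus K}|b_g|/\sigma(L(g))^R<\epsilon$. *)

(* Defs.v *)
From HB Require Import structures.
From mathcomp Require Import all_boot all_order all_algebra.
From mathcomp Require Import complex.
From mathcomp Require Import all_classical all_reals all_analysis.
From mathcomp Require summability.

Set Implicit Arguments.
Unset Strict Implicit.
Unset Printing Implicit Defensive.
Import Order.TTheory GRing.Theory Num.Theory.
Import numFieldNormedType.Exports.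

Local Open Scope classical_set_scope.
Local Open Scope ring_scope.

Section WordLength.
Variable G : groupType.

Definition symmetric_set (S : set G) : Prop := [set (g^-1)%g | g in S] = S.

(* The only subgroup of G containing S is G itself. *)
Definition generates (S : set G) : Prop :=
  forall H : set G, group_closed [in H] -> S `<=` H -> H = setT.

Definition is_word (S : set G) (g : G) (n : nat) : Prop :=
  exists w : seq G,
    [/\ size w = n, forall x, x \in w -> S x & (\prod_(x <- w) x)%g = g].

(* When g is not a product of elements of S (which never happens if S is
   symmetric and generates G) the value is the junk value 0. *)
Definition word_length (S : set G) (g : G) : nat :=
  if pselect (exists n, `[< is_word S g n >]) is left e then ex_minn e else 0%N.

End WordLength.

Section Growth.
Variable R : realType.

Definition growth_function (sigma : nat -> R) : Prop :=
  [/\ forall n, 1 <= sigma n,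
      forall n, sigma n <= sigma n.+1 &
      ~ has_ubound (range sigma)].

Definition submultiplicative (sigma : nat -> R) : Prop :=
  forall n m, sigma (n + m)%N <= sigma n * sigma m.

End Growth.

(* R[i]^o is R[i] viewed as a normed module over itself. *)
Notation formal_series G R := (G -> R[i]^o).

Section WeightedSpaces.
Variables (R : realType) (G : groupType).
Variables (L : G -> nat) (sigma : nat -> R) (r : R).

Definition modulus (z : R[i]^o) : R := ComplexField.Normc.normc (z : R[i]).

Definition norm_l1 (a : formal_series G R) : \bar R :=
  \esum_(g in [set: G]) (modulus (a g) * sigma (L g) `^ r)%:E.

Definition l1_space : set (formal_series G R) := [set a | (norm_l1 a < +oo)%E].

Definition norm_linfty (b : formal_series G R) : \bar R :=
  ereal_sup [set (modulus (b g) / sigma (L g) `^ r)%:E | g in [set: G]].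

Definition linfty_space : set (formal_series G R) :=
  [set b | (norm_linfty b < +oo)%E].

Definition c0_space : set (formal_series G R) :=
  [set b | forall eps : R, 0 < eps -> exists2 K : set G, finite_set K &
    (ereal_sup [set (modulus (b g) / sigma (L g) `^ r)%:E | g in ~` K]
       < eps%:E)%E].

End WeightedSpaces.

Section Convolution.
Variables (R : realType) (G : groupType).
Implicit Types a b : formal_series G R.

Definition convolution_term a b (h g : G) : R[i]^o := a g * b (g^-1 * h)%g.

(* Unconditional convergence: the partial sums over the finite subsets of G,
   directed by inclusion, converge. *)
Definition convolution_defined a b : Prop :=
  forall h, cvg (summability.partial_sum (convolution_term a b h)
                   @ summability.totally).

Definition convolution a b : formal_series G R :=
  fun h => summability.sum (convolution_term a b h).

(* V is a sub-bimodule of M over A, where A and M are subspaces of C[[G]] and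
   both actions are given by convolution.  As [convolution] is total, the
   existence of the products is stated separately. *)
Definition sub_bimodule (A M V : set (formal_series G R)) : Prop :=
  [/\ V `<=` M,
      submod_closed [in V] &
      forall a b, A a -> V b ->
        [/\ convolution_defined a b, convolution_defined b a,
            V (convolution a b) & V (convolution b a)]].

End Convolution.

(* Main.v *)
(* The weights w(g) = sigma(L g)^r satisfy w(gh) <= w(g) w(h) and w(g^-1) = w(g).
   Hence, if |b| <= C w, the terms a_g b_{g^-1 h} are bounded by C |a_g| w(g) w(h),
   and the sums converge absolutely.  Given small delta, choose a finite K with
   |b| <= delta w outside K and a finite F outside which |a| w has small sum.  For h
   outside the finite set F K, each term is either at most delta |a_g| w(g) w(h)
   or has g outside F, so that |(ab)_h| / w(h) is small; likewise for ba. *)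
Require Import Defs.
From mathcomp Require Import all_boot all_order all_algebra.
From mathcomp Require Import finmap complex.
From mathcomp Require Import all_classical all_reals all_analysis.
From mathcomp Require Import lra.
From mathcomp Require summability.

Set Implicit Arguments.
Unset Strict Implicit.
Unset Printing Implicit Defensive.
Import Order.TTheory GRing.Theory Num.Theory.
Import numFieldNormedType.Exports.

Local Open Scope classical_set_scope.
Local Open Scope ring_scope.

#[local] Existing Instance summability.totally_filter.

(** * Unconditional convergence of real families *)

Section UnconditionalSums.
Variables (R : realType) (I : choiceType).
Implicit Types (f : I -> R) (s : seq I).

(** Duplicate-free lists stand for finite subsets, which keeps bounds in [R] and makes reindexing a
    [map]. *)
Definition sums_le f (M : R) : Prop :=
  forall s, uniq s -> \sum_(i <- s) f i <= M.

Lemma ler_sum_subset f s t : (forall i, 0 <= f i) -> uniq s ->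
  {subset s <= t} -> \sum_(i <- s) f i <= \sum_(i <- t) f i.
Proof.
move=> f0; elim: s t => [|x s IH] t; first by rewrite big_nil sumr_ge0.
move=> /= /andP[xs us] st; have xt : x \in t by apply: st; rewrite mem_head.
rewrite big_cons (perm_big _ (perm_to_rem xt)) big_cons lerD2l; apply: IH => // y ys.
have := st y; rewrite inE ys orbT => /(_ isT).
rewrite (perm_mem (perm_to_rem xt)) inE => /predU1P[yx|//].
by rewrite -yx ys in xs.
Qed.

Lemma sums_le_adherent f M : sums_le f M ->
  exists2 l, sums_le f l &
    forall e, 0 < e -> exists2 s, uniq s & l - e < \sum_(i <- s) f i.
Proof.
move=> fM; pose E := [set x | exists2 s, uniq s & \sum_(i <- s) f i = x].
have supE : has_sup E.
  by split; [exists 0, [::]; rewrite ?big_nil|exists M => _ [s us <-]; apply: fM].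
exists (sup E) => [s us|e e0]; first by apply: sup_upper_bound => //; exists s.
by have [_ [s us <-] ?] := sup_adherent e0 supE; exists s.
Qed.

(** A list [t] whose sum is within [e] of the supremum leaves at most [e] for any list disjoint from
    it, since the concatenation still sums to at most the supremum. *)
Lemma sums_le_tail f M : sums_le f M -> forall e, 0 < e ->
  exists t : seq I, forall s, uniq s -> \sum_(i <- s | i \notin t) f i <= e.
Proof.
move=> fM e e0; have [l fl /(_ _ e0)[t ut lt]] := sums_le_adherent fM.
exists t => s us; rewrite -big_filter.
suff : \sum_(i <- [seq i <- s | i \notin t] ++ t) f i <= l by rewrite big_cat/=; lra.
apply: fl; rewrite cat_uniq filter_uniq//= ut andbT.
by apply/hasPn => x xt; rewrite mem_filter xt.
Qed.

Lemma partial_sumE (V : zmodType) (f : I -> V) (A : {fset I}) :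
  summability.partial_sum f A = \sum_(i <- A) f i.
Proof. by rewrite /summability.partial_sum big_seq_fsetE. Qed.

(** Finite sums grow with the index set, so past a nearly optimal list they stay within [e] of their
    supremum. *)
Lemma ge0_partial_sum_cvg f M : (forall i, 0 <= f i) -> sums_le f M ->
  exists l : R, summability.partial_sum f @ summability.totally --> l.
Proof.
move=> f0 fM; have [l fl lE] := sums_le_adherent fM; exists l.
apply/cvgrPdist_lt => e /lE[s us lt].
exists [fset i in s]%fset => // A /= sA.
rewrite partial_sumE ger0_norm ?subr_ge0 ?fl//.
suff : \sum_(i <- s) f i <= \sum_(i <- A) f i by lra.
by apply: ler_sum_subset => // i si; apply: (fsubsetP sA); rewrite inE.
Qed.

Lemma partial_sum_cvg f M : sums_le (fun i => `|f i|) M ->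
  exists l : R, summability.partial_sum f @ summability.totally --> l.
Proof.
move=> fM.
(* Write [f] as the difference of the nonnegative families [f + |f|] and [|f|], both with bounded
   sums. *)
have [i||l1 c1] := @ge0_partial_sum_cvg (fun i => f i + `|f i|) (M + M).
- by have := ler_norm (- f i); rewrite normrN; lra.
- move=> s us; rewrite big_split/= lerD ?fM//; apply: le_trans (fM s us).
  by apply: ler_sum => i _; exact: ler_norm.
have [//|//|l2 c2] := @ge0_partial_sum_cvg (fun i => `|f i|) M.
exists (l1 - l2).
have -> : summability.partial_sum f = summability.partial_sum (fun i => f i + `|f i|)
    \- summability.partial_sum (fun i => `|f i|).
  by apply/funext => A; rewrite /= !partial_sumE -sumrB; apply: eq_bigr => i _; rewrite addrK.
exact: cvgB.
Qed.

End UnconditionalSums.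

(** * The complex modulus and absolutely convergent complex sums *)

Section Modulus.
Variable R : realType.
Implicit Types z u : R[i]^o.

Lemma modulusE z : (modulus z)%:C%C = `|z : R[i]|.
Proof. by []. Qed.

Lemma modulus_ge0 z : 0 <= modulus z.
Proof. by rewrite -ler0c; exact: (normr_ge0 (z : R[i])). Qed.

Lemma modulus0 : modulus (0 : R[i]^o) = 0.
Proof. exact: ComplexField.Normc.normc0. Qed.

Lemma modulusM (z u : R[i]) : modulus (z * u) = modulus z * modulus u.
Proof. exact: ComplexField.Normc.normcM. Qed.

Lemma modulusD z u : modulus (z + u) <= modulus z + modulus u.
Proof. exact: le_normcD. Qed.

Lemma modulus_sum (I : Type) (s : seq I) (t : I -> R[i]^o) :
  modulus (\sum_(i <- s) t i) <= \sum_(i <- s) modulus (t i).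
Proof.
elim: s => [|x s IH]; first by rewrite !big_nil modulus0.
by rewrite !big_cons (le_trans (modulusD _ _))// lerD2l.
Qed.

Lemma Re_le_modulus z : `|complex.Re z| <= modulus z.
Proof. by rewrite -lecR modulusE; exact: normc_ge_Re. Qed.

Lemma Im_le_modulus z : `|complex.Im z| <= modulus z.
Proof.
case: z => x y; rewrite /modulus /= -sqrtr_sqr ler_wsqrtr//.
by rewrite lerDr sqr_ge0.
Qed.

Lemma modulus_le_ReIm z : modulus z <= `|complex.Re z| + `|complex.Im z|.
Proof.
case: z => x y; rewrite /modulus /= -[leRHS]ger0_norm ?addr_ge0//.
rewrite -sqrtr_sqr ler_wsqrtr// sqrrD !real_normK ?num_real//.
by rewrite -addrA lerD2l lerDr mulrn_wge0// mulr_ge0.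
Qed.

Lemma Re_sum (I : Type) (s : seq I) (t : I -> R[i]^o) :
  complex.Re (\sum_(i <- s) t i) = \sum_(i <- s) complex.Re (t i).
Proof. by apply: (big_morph (@complex.Re R)) => // -[? ?] [? ?]. Qed.

Lemma Im_sum (I : Type) (s : seq I) (t : I -> R[i]^o) :
  complex.Im (\sum_(i <- s) t i) = \sum_(i <- s) complex.Im (t i).
Proof. by apply: (big_morph (@complex.Im R)) => // -[? ?] [? ?]. Qed.

(** The norm of [R[i]^o] has values in [R[i]], so the radii in the library's criterion are complex;
    a positive one has zero imaginary part. *)
Lemma cvg_modulusP (T : Type) (F : set_system T) (FF : Filter F)
    (u : T -> R[i]^o) z :
  u @ F --> z <->
  forall e : R, 0 < e -> \forall x \near F, modulus (z - u x) < e.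
Proof.
split=> [/cvgrPdist_lt uz e e0|uz].
  have : (0 : R[i]) < e%:C%C by rewrite ltcR.
  by move=> /uz; apply: filterS => x; rewrite /= -ltcR.
apply/cvgrPdist_lt => -[e e'] /=; rewrite ltcE/= => /andP[/eqP-> e0].
by apply: filterS (uz e e0) => x; rewrite -ltcR.
Qed.

Variable I : choiceType.
Implicit Type t : I -> R[i]^o.

(** Real and imaginary parts are dominated by the modulus, so each converges absolutely. *)
Lemma modulus_partial_sum_cvg t M : sums_le (fun i => modulus (t i)) M ->
  cvg (summability.partial_sum t @ summability.totally).
Proof.
move=> tM.
have dom (p : R[i]^o -> R) : (forall z, `|p z| <= modulus z) ->
    sums_le (fun i => `|p (t i)|) M.
  move=> pm s us; apply: le_trans (tM s us).
  by apply: ler_sum => i _; exact: pm.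
have [x xP] := partial_sum_cvg (dom _ Re_le_modulus).
have [y yP] := partial_sum_cvg (dom _ Im_le_modulus).
apply/cvg_ex; exists (x +i* y)%C; apply/cvg_modulusP => e e0.
have e20 : 0 < e / 2 by rewrite divr_gt0.
move/cvgrPdist_lt : xP => /(_ _ e20) xP; move/cvgrPdist_lt : yP => /(_ _ e20) yP.
apply: filterS2 xP yP => A; rewrite !partial_sumE -Re_sum -Im_sum => xA yA.
apply: le_lt_trans (modulus_le_ReIm _) _.
move: xA yA; case: (\sum_(i <- A) t i) => a b /=; lra.
Qed.

(** The sum lies within any [e] of a finite partial sum, to which the triangle inequality
    applies. *)
Lemma modulus_sum_le t M : sums_le (fun i => modulus (t i)) M ->
  modulus (summability.sum t) <= M.
Proof.
move=> tM; apply/ler_addgt0Pr => e e0.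
have /cvg_modulusP/(_ _ e0)[A _ /(_ A (fsubset_refl A))] :=
  modulus_partial_sum_cvg tM.
rewrite -/(summability.sum t) partial_sumE => lt.
rewrite -[summability.sum t](subrK (\sum_(i <- A) t i)).
rewrite (le_trans (modulusD _ _))// addrC lerD//; last exact: ltW.
by rewrite (le_trans (modulus_sum _ _))//; exact: tM.
Qed.

End Modulus.

(** * Subadditivity and symmetry of word length *)

Section WordLengthTheory.
Variables (G : groupType) (S : set G).
Hypotheses (S_sym : symmetric_set S) (S_gen : generates S).

Lemma is_wordM g h m n :
  is_word S g m -> is_word S h n -> is_word S (g * h)%g (m + n).
Proof.
move=> [v [<- vS <-]] [w [<- wS <-]]; exists (v ++ w).
split; [by rewrite size_cat| |by rewrite big_cat].
by move=> x; rewrite mem_cat => /orP[/vS|/wS].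
Qed.

Lemma is_wordV g n : is_word S g n -> is_word S g^-1%g n.
Proof.
move=> [w [<- wS <-]]; exists [seq x^-1%g | x <- rev w].
split; [by rewrite size_map size_rev| |].
  move=> _ /mapP[x + ->]; rewrite mem_rev => /wS Sx.
  by rewrite -S_sym; exists x.
by rewrite big_map prodgV revK.
Qed.

(** Products of elements of [S] form a subgroup containing [S]; hence [word_length] never takes its
    junk value. *)
Lemma is_word_ex g : exists n, is_word S g n.
Proof.
suff HT : [set h | exists n, is_word S h n] = setT.
  by have : [set h | exists n, is_word S h n] g by rewrite HT.
apply: S_gen; last first.
  by move=> x Sx; exists 1%N, [:: x]; split => // [y /[!inE]/eqP->|]; rewrite ?big_seq1.
split; first by rewrite inE; exists 0%N, [::]; split; rewrite ?big_nil.
move=> x y /set_mem[m xm] /set_mem[n yn]; apply/mem_set.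
by exists (m + n)%N; apply: is_wordM => //; exact: is_wordV.
Qed.

Lemma word_lengthP g : is_word S g (word_length S g).
Proof.
rewrite /word_length; case: pselect => [e|]; first by case: ex_minnP => n /asboolP.
by case; have [n gn] := is_word_ex g; exists n; apply/asboolP.
Qed.

Lemma word_length_le g n : is_word S g n -> (word_length S g <= n)%N.
Proof.
move=> gn; rewrite /word_length; case: pselect => [e|//].
by case: ex_minnP => m _; apply; apply/asboolP.
Qed.

Lemma word_lengthM g h :
  (word_length S (g * h)%g <= word_length S g + word_length S h)%N.
Proof. by apply/word_length_le/is_wordM; exact: word_lengthP. Qed.

Lemma word_lengthV g : word_length S g^-1%g = word_length S g.
Proof.
have le h : (word_length S h^-1%g <= word_length S h)%N.
  by apply/word_length_le/is_wordV/word_lengthP.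
by apply/eqP; rewrite eqn_leq le -{1}[g]invgK le.
Qed.

End WordLengthTheory.

(** * Weights, the weighted spaces, and the main estimate *)

Section Weights.
Variables (R : realType) (G : groupType) (L : G -> nat) (sigma : nat -> R) (r : R).
Hypotheses (sigma_growth : growth_function sigma)
  (sigma_submul : submultiplicative sigma) (r_ge0 : 0 <= r)
  (LM : forall g h, (L (g * h)%g <= L g + L h)%N).

Lemma weight_gt0 g : 0 < sigma (L g) `^ r.
Proof. by have [s1 _ _] := sigma_growth; rewrite powR_gt0// (lt_le_trans ltr01). Qed.

Lemma weight_ge0 g : 0 <= sigma (L g) `^ r.
Proof. exact/ltW/weight_gt0. Qed.

Lemma weightM g h :
  sigma (L (g * h)%g) `^ r <= sigma (L g) `^ r * sigma (L h) `^ r.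
Proof.
have [s1 sS _] := sigma_growth.
have s0 n : 0 <= sigma n by rewrite (le_trans ler01).
rewrite -powRM// ge0_ler_powR// ?nnegrE ?mulr_ge0//.
apply: le_trans (sigma_submul _ _).
exact: (homo_leq lexx le_trans sS).
Qed.

Lemma l1_space_sums_le (a : formal_series G R) : l1_space L sigma r a ->
  exists M, sums_le (fun g => modulus (a g) * sigma (L g) `^ r) M.
Proof.
have f0 g : 0 <= modulus (a g) * sigma (L g) `^ r.
  by rewrite mulr_ge0 ?modulus_ge0// weight_ge0.
rewrite /l1_space/= => afin; exists (fine (norm_l1 L sigma r a)) => s us.
rewrite -lee_fin fineK; last first.
  by rewrite ge0_fin_numE//; apply: esum_ge0 => g _; rewrite lee_fin.
rewrite /norm_l1; apply: esum_ge; exists [set` s]; first by split.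
by rewrite -sumEFin fsbig_seq.
Qed.

(** This pointwise form avoids the supremum, which is [-oo] when [K] is all of [G]. *)
Lemma c0_spaceP (b : formal_series G R) : c0_space L sigma r b <->
  forall e, 0 < e -> exists2 K : set G, finite_set K &
    forall g, ~ K g -> modulus (b g) <= e * sigma (L g) `^ r.
Proof.
split=> bP e e0.
  have [K finK] := bP e e0; set E := [set _ | _ in _] => /ltW supE.
  exists K => // g Kg; rewrite -ler_pdivrMr ?weight_gt0// -lee_fin.
  by apply: le_trans supE; apply: ereal_sup_ubound; exists g.
(* Halving [e] recovers the strict inequality for the supremum. *)
have [K finK bK] := bP (e / 2) (divr_gt0 e0 (ltr0Sn _ 1)).
exists K => //; apply: (@le_lt_trans _ _ (e / 2)%:E); last by rewrite lte_fin; lra.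
apply: ge_ereal_sup => _ [g /= Kg <-].
by rewrite lee_fin ler_pdivrMr ?weight_gt0//; exact: bK.
Qed.

Lemma c0_space_bounded (b : formal_series G R) : c0_space L sigma r b ->
  exists2 C, 0 <= C & forall g, modulus (b g) <= C * sigma (L g) `^ r.
Proof.
move=> /c0_spaceP/(_ _ ltr01)[_ /finite_seqP[s ->] bs].
(* The ratio is at most 1 off [s]; on [s] it is one of the nonnegative summands of [C]. *)
pose C := \sum_(g <- s) modulus (b g) / sigma (L g) `^ r.
have f0 g : 0 <= modulus (b g) / sigma (L g) `^ r.
  by rewrite divr_ge0 ?modulus_ge0// weight_ge0.
have C0 : 0 <= C by exact: sumr_ge0.
exists (1 + C) => [|g]; first by rewrite addr_ge0.
have [gs|/bs bg] := pselect (g \in s); last first.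
  by apply: le_trans bg _; rewrite ler_wpM2r// ?weight_ge0// lerDl.
rewrite -ler_pdivrMr ?weight_gt0// (@le_trans _ _ C)//; last by rewrite lerDr.
rewrite -[leLHS](big_seq1 +%R g (fun g => modulus (b g) / sigma (L g) `^ r)).
by apply: ler_sum_subset => // h /[!inE]/eqP->.
Qed.

Lemma c0_space_sub_linfty : c0_space L sigma r `<=` linfty_space L sigma r.
Proof.
move=> b /c0_space_bounded[C _ bC]; apply: (@le_lt_trans _ _ C%:E); last exact: ltry.
apply: ge_ereal_sup => _ [g _ <-].
by rewrite lee_fin ler_pdivrMr ?weight_gt0.
Qed.

Lemma c0_space_submod :
  submod_closed [in (c0_space L sigma r : set (formal_series G R))].
Proof.
split.
  apply/mem_set/c0_spaceP => e e0; exists set0 => [|g _]; first exact: finite_set0.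
  by rewrite [leLHS]modulus0 mulr_ge0 ?weight_ge0 ?ltW.
move=> c a b /set_mem/c0_spaceP aP /set_mem/c0_spaceP bP.
apply/mem_set/c0_spaceP => e e0.
have c0 : 0 <= modulus c by exact: modulus_ge0.
(* Adding 1 to the denominator covers [c = 0]. *)
have d0 : 0 < e / 2 / (modulus c + 1) by rewrite !divr_gt0// ltr_wpDl.
have [K finK aK] := aP _ d0; have [K' finK' bK'] := bP _ (divr_gt0 e0 (ltr0Sn _ 1)).
exists (K `|` K') => [|g]; first by rewrite finite_setU.
move=> /not_orP[/aK ag /bK' bg]; apply: le_trans (modulusD _ _) _.
rewrite modulusM [e]splitr mulrDl lerD//.
apply: le_trans (ler_wpM2l c0 ag) _; rewrite mulrA ler_wpM2r ?weight_ge0//.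
rewrite mulrCA ler_piMr ?divr_ge0 ?ltW// ltr_pdivrMr; lra.
Qed.

(* Covers both products: [rho h g] and [beta h g] are the arguments of [a] and
   [b] in the [g]-th term of the value at [h], and [psi] multiplies them back to
   [h]. *)
Lemma c0_space_twisted_sum (rho beta psi : G -> G -> G) (a b : formal_series G R)
    (t : G -> G -> R[i]^o) :
  (forall h, injective (rho h)) ->
  (forall h g, psi (rho h g) (beta h g) = h) ->
  (forall h g, sigma (L (beta h g)) `^ r <=
     sigma (L (rho h g)) `^ r * sigma (L h) `^ r) ->
  (forall h g, modulus (t h g) = modulus (a (rho h g)) * modulus (b (beta h g))) ->
  l1_space L sigma r a -> c0_space L sigma r b ->
  (forall h, cvg (summability.partial_sum (t h) @ summability.totally)) /\
  c0_space L sigma r (fun h => summability.sum (t h)).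
Proof.
move=> rho_inj psiE wM tE aP bP.
have [A aA] := l1_space_sums_le aP; have [C C0 bC] := c0_space_bounded bP.
pose w g := sigma (L g) `^ r; pose f g := modulus (a g) * w g.
have w0 g : 0 <= w g by exact: weight_ge0.
have a0 g : 0 <= modulus (a g) by exact: modulus_ge0.
have f0 g : 0 <= f g by rewrite mulr_ge0 ?w0.
have A0 : 0 <= A by have := aA [::] isT; rewrite big_nil.
(* Used with [c = C] for all [g], and with a small [c] where [beta h g] avoids the exceptional set
   of [b]. *)
have term h g c : 0 <= c -> modulus (b (beta h g)) <= c * w (beta h g) ->
    modulus (t h g) <= w h * (c * f (rho h g)).
  move=> c0 bc; rewrite tE; apply: le_trans (ler_wpM2l (a0 _) bc) _.
  rewrite mulrA; apply: le_trans (ler_wpM2l (mulr_ge0 (a0 _) c0) (wM _ _)) _.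
  by rewrite /f /w; lra.
split=> [h|].
  apply: (@modulus_partial_sum_cvg _ _ _ (w h * (C * A))) => s us.
  apply: (@le_trans _ _ (\sum_(g <- s) w h * (C * f (rho h g)))).
    by apply: ler_sum => g _; exact: term.
  (* Injectivity of [rho h] keeps the reindexed list duplicate-free, so the bound [A] applies. *)
  rewrite -!mulr_sumr !ler_wpM2l ?w0// -(big_map (rho h) xpredT f).
  by apply: aA; rewrite map_inj_uniq.
apply/c0_spaceP => e e0.
(* Chosen so that [d * A] and [C * d'] are at most [e / 2]; the added 1 covers [A = 0] and
   [C = 0]. *)
pose d := e / 2 / (A + 1); pose d' := e / 2 / (C + 1).
have d0 : 0 < d by rewrite !divr_gt0// ltr_wpDl.
have d'0 : 0 < d' by rewrite !divr_gt0// ltr_wpDl.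
have dA : d * A <= e / 2 by rewrite /d mulrAC ler_pdivrMr ?ler_wpM2l//; lra.
have dC : C * d' <= e / 2 by rewrite /d' mulrCA ler_piMr ?ler_pdivrMr//; lra.
have [K finK bK] := (c0_spaceP b).1 bP _ d0.
have [F tailF] := sums_le_tail aA d'0.
(* For [h] outside this set, [rho h g] in [F] forces [beta h g] out of [K], by [psiE]. *)
exists [set psi x k | x in [set` F] & k in K].
  by apply: finite_image2 => //; exact: finite_seq.
move=> h hFK; apply: modulus_sum_le => s us.
(* The [d] summand is kept for every [g], so its sum is bounded by [A]; the [C] summand survives
   only off [F], where the tail bound [d'] applies. *)
apply: (@le_trans _ _ (\sum_(g <- s) (w h * (d * f (rho h g)) +
    if rho h g \notin F then w h * (C * f (rho h g)) else 0))).
  apply: ler_sum => g _; case: ifPn => [_|/negbNE gF].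
    by rewrite ler_wpDl ?term// mulr_ge0 ?w0// mulr_ge0 ?f0// ltW.
  rewrite addr0; apply: term; first exact: ltW.
  apply: bK => Kg; apply: hFK; exists (rho h g) => //; exists (beta h g) => //.
rewrite big_split/= -big_mkcond -!mulr_sumr/= -mulrDr mulrC ler_wpM2r ?w0//.
rewrite -(big_map (rho h) xpredT f) -(big_map (rho h) (fun g => g \notin F) f).
rewrite [e]splitr; set u := map _ _; have uu : uniq u by rewrite map_inj_uniq.
apply: lerD.
  by apply: le_trans dA; rewrite ler_wpM2l ?(ltW d0)//; exact: aA.
by apply: le_trans dC; rewrite ler_wpM2l//; exact: tailF.
Qed.

End Weights.

Theorem theorem8p2 (R : realType) (G : groupType) (S : set G)
    (S_finite : finite_set S) (S_sym : symmetric_set S)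
    (S_gen : generates S)
    (sigma : nat -> R) (sigma_growth : growth_function sigma)
    (sigma_submul : submultiplicative sigma)
    (r : R) (r_ge0 : 0 <= r) :
  sub_bimodule
    (l1_space (word_length S) sigma r)
    (linfty_space (word_length S) sigma r)
    (c0_space (word_length S) sigma r).
Proof.
have LM := word_lengthM S_sym S_gen; have LV := word_lengthV S_sym S_gen.
split; [exact: c0_space_sub_linfty|exact: c0_space_submod|move=> a b aP bP].
have wM := weightM sigma_growth sigma_submul r_ge0 LM.
have wMl h g : sigma (word_length S (g^-1 * h)%g) `^ r <=
    sigma (word_length S g) `^ r * sigma (word_length S h) `^ r.
  by rewrite -(LV g); exact: wM.
(* Here [g] is written as [h] times the inverse of [g^-1 * h]. *)
have wMr h g : sigma (word_length S g) `^ r <=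
    sigma (word_length S (g^-1 * h)%g) `^ r * sigma (word_length S h) `^ r.
  by rewrite -(LV (g^-1 * h)%g) invgM invgK mulrC -{1}(mulVKg h g); exact: wM.
have [cab ab] := c0_space_twisted_sum sigma_growth (rho := fun=> id)
  (beta := fun h g => (g^-1 * h)%g) (psi := fun x k => (x * k)%g)
  (t := convolution_term a b) (fun h => @inj_id _) (fun h g => mulVKg g h)
  wMl (fun h g => modulusM _ _) aP bP.
have tE h g : modulus (convolution_term b a h g) =
    modulus (a (g^-1 * h)%g) * modulus (b g) by rewrite mulrC; exact: modulusM.
(* In [ba] the index [g] is the argument of [b], so [a] is evaluated at [g^-1 * h], which is
   injective in [g], and [psi] multiplies in the opposite order. *)
have [cba ba] := c0_space_twisted_sum sigma_growth
  (rho := fun h g => (g^-1 * h)%g) (beta := fun=> id) (psi := fun x k => (k * x)%g)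
  (fun h x y e => invg_inj (mulIg h _ _ e)) (fun h g => mulVKg g h) wMr tE aP bP.
split.
- exact: cab.
- exact: cba.
- exact: ab.
- exact: ba.
Qed.
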